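(* Let $(X,f)$ be a topological dynamical system, i.e. $X$ is a compact metric space and $f:X\to X$ is continuous. Suppose that $(X,f)$ satisfies the shadowing property or the almost specification property. Then $$h_{top}(f,NRec(f))=h_{top}(f),$$ where $NRec(f)$ is the set of nonrecurrent points of $f$.
   Context: $X$ is a compact metric space with metric $d$, and $f:X\to X$ is continuous. Recurrence. $\omega_f(x)=\bigcap_{n\ge1}\overline{\bigcup_{k\ge n}\{f^k(x)\}}$. A point $x$ is recurrent if $x\in\omega_f(x)$, otherwise nonrecurrent. $NRec(f)$ is the set of nonrecurrent points. Bowen topological entropy of a subset. $d_n(x,y)=\max\{d(f^i(x),f^i(y)):0\le i\le n-1\}$, $B_n(x,\varepsilon)=\{y\in X:d_n(x,y)<\varepsilon\}$. For $E\subseteq X$, let $\mathcal G_n(E,\sigma)$ be the collection of all finite or countable covers of $E$ by sets $B_u(x,\sigma)$ with $u\ge n$. For $t\ge 0$ put $C(E;t,n,\sigma,f)=\inf_{\mathcal C\in\mathcal G_n(E,\sigma)}\sum_{B_u(x,\sigma)\in\mathcal C}e^{-tu}$, $C(E;t,\sigma,f)=\lim_{n\to\infty}C(E;t,n,\sigma,f)$, $h_{top}(E;\sigma,f)=\inf\{t:C(E;t,\sigma,f)=0\}$ and $h_{top}(f,E)=\lim_{\sigma\to0}h_{top}(E;\sigma,f)$. Also $h_{top}(f)=h_{top}(f,X)$. Shadowing property. For every $\varepsilon>0$ there is $\delta>0$ such that for every sequence $\{x_n\}_{n\ge0}$ in $X$ with $d(f(x_n),x_{n+1})<\delta$ for all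 $n\ge0$ there is $y\in X$ with $d(f^n(y),x_n)<\varepsilon$ for all $n\ge0$. Almost specification property. A mistake function is $g:\mathbb N\times(0,\varepsilon_0]\to\mathbb N$ (for some $\varepsilon_0>0$) with $g(n,\varepsilon)\le g(n+1,\varepsilon)$ and $\lim_{n\to\infty}g(n,\varepsilon)/n=0$ for all $\varepsilon$; for $\varepsilon>\varepsilon_0$ put $g(n,\varepsilon)=g(n,\varepsilon_0)$. With $\Lambda_n=\{0,1,\dots,n-1\}$ let $$B_n(g;x,\varepsilon)=\{y\in X:\exists\,\Lambda\subseteq\Lambda_n,\ |\Lambda_n\setminus\Lambda|\le g(n,\varepsilon),\ \max\{d(f^j(x),f^j(y)):j\in\Lambda\}\le\varepsilon\}$$ (for $n$ large enough that $g(n,\varepsilon)<n$). $(X,f)$ has the almost specification property if for some mistake function $g$ there is a function $k_g:(0,\infty)\to\mathbb N$ such that for any $\varepsilon_1,\dots,\varepsilon_m>0$, any $x_1,\dots,x_m\in X$ and any integers $n_1\ge k_g(\varepsilon_1),\dots,n_m\ge k_g(\varepsilon_m)$ there is $z\in X$ with $f^{l_j}(z)\in B_{n_j}(g;x_j,\varepsilon_j)$ for $j=1,\dots,m$, where $n_0=0$ and $l_j=\sum_{s=0}^{j-1}n_s$. *)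

(* Defs.v *)
From HB Require Import structures.
From mathcomp Require Import all_boot all_order all_algebra.
From mathcomp Require Import all_classical all_reals all_analysis.

Set Implicit Arguments.
Unset Strict Implicit.
Unset Printing Implicit Defensive.

Import Order.TTheory GRing.Theory Num.Theory.
Import numFieldNormedType.Exports.

Local Open Scope classical_set_scope.
Local Open Scope ring_scope.

Definition omega_limit (R : realType) (X : metricType R) (f : X -> X) (x : X)
    : set X :=
  \bigcap_(n in [set n : nat | (1 <= n)%N])
    closure (\bigcup_(k in [set k : nat | (n <= k)%N]) [set iter k f x]).

Definition recurrent (R : realType) (X : metricType R) (f : X -> X) (x : X)
    : Prop :=
  omega_limit f x x.

Definition NRec (R : realType) (X : metricType R) (f : X -> X) : set X :=
  [set x | ~ recurrent f x].

Definition bowen_dist (R : realType) (X : metricType R) (f : X -> X) (n : nat)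
    (x y : X) : R :=
  \big[Num.max/0]_(i < n) mdist (iter i f x) (iter i f y).

Definition bowen_ball (R : realType) (X : metricType R) (f : X -> X) (n : nat)
    (x : X) (eps : R) : set X :=
  [set y | bowen_dist f n x y < eps].

(* A cover by sets B_u(x, sigma) is encoded by the set of its labels (x, u):
   the weight exp(-tu) depends on u, which the bare set B_u(x, sigma) need not
   determine. *)
Definition bowen_covers (R : realType) (X : metricType R) (f : X -> X)
    (E : set X) (n : nat) (sigma : R) : set (set (X * nat)) :=
  [set C | countable C /\
           (forall p, C p -> (n <= p.2)%N) /\
           E `<=` \bigcup_(p in C) bowen_ball f p.2 p.1 sigma].

Definition entropy_sum (R : realType) (X : metricType R) (f : X -> X)
    (E : set X) (t : R) (n : nat) (sigma : R) : \bar R :=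
  ereal_inf [set (\esum_(p in C) (expR (- (t * p.2%:R)))%:E)%E
            | C in bowen_covers f E n sigma].

Definition entropy_measure (R : realType) (X : metricType R) (f : X -> X)
    (E : set X) (t sigma : R) : \bar R :=
  lim ((fun n : nat => entropy_sum f E t n sigma) @ \oo).

Definition htop_scale (R : realType) (X : metricType R) (f : X -> X)
    (E : set X) (sigma : R) : \bar R :=
  ereal_inf [set t%:E
            | t in [set t : R | 0 <= t /\ entropy_measure f E t sigma = 0%E]].

Definition htop (R : realType) (X : metricType R) (f : X -> X) (E : set X)
    : \bar R :=
  lim (htop_scale f E @ 0^'+).

Definition shadowing (R : realType) (X : metricType R) (f : X -> X) : Prop :=
  forall eps : R, 0 < eps -> exists2 delta : R, 0 < delta &
    forall x : nat -> X,
      (forall n, mdist (f (x n)) (x n.+1) < delta) ->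
      exists y : X, forall n, mdist (iter n f y) (x n) < eps.

(* [g n eps] is meaningful only for [0 < eps]; the last clause is the extension
   of g from (0, eps0] to (0, oo). *)
Definition mistake_function (R : realType) (g : nat -> R -> nat) : Prop :=
  exists2 eps0 : R, 0 < eps0 &
    (forall eps : R, 0 < eps <= eps0 ->
       (forall n, (g n eps <= g n.+1 eps)%N) /\
       ((fun n : nat => (g n eps)%:R / n%:R : R) @ \oo --> (0 : R))) /\
    (forall (n : nat) (eps : R), eps0 < eps -> g n eps = g n eps0).

Definition mistake_ball (R : realType) (X : metricType R) (f : X -> X)
    (g : nat -> R -> nat) (n : nat) (x : X) (eps : R) : set X :=
  [set y | exists L : {set 'I_n},
     (#|~: L| <= g n eps)%N /\
     \big[Num.max/0]_(j in L) mdist (iter j f x) (iter j f y) <= eps].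

(* B_n(g; x, eps) is only considered when g(n, eps) < n, so k must select such
   n; since g(n, eps) / n tends to 0, this can always be achieved by enlarging
   k, which preserves the other clause.  Indices are shifted to start at 0, so
   that l_j is the sum of the n_s with s < j. *)
Definition almost_specification (R : realType) (X : metricType R) (f : X -> X)
    : Prop :=
  exists2 g : nat -> R -> nat, mistake_function g &
  exists k : R -> nat,
    (forall (eps : R) (n : nat), 0 < eps -> (k eps <= n)%N -> (g n eps < n)%N) /\
    (forall (m : nat) (eps : 'I_m -> R) (x : 'I_m -> X) (n : 'I_m -> nat),
       (0 < m)%N ->
       (forall j, 0 < eps j) ->
       (forall j, (k (eps j) <= n j)%N) ->
       exists z : X, forall j : 'I_m,
         mistake_ball f g (n j) (x j) (eps j)
           (iter (\sum_(s < m | (s < j)%N) n s)%N f z)).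

(* Main.v *)
Require Import Defs.
From mathcomp Require Import all_boot all_order all_algebra.
From mathcomp Require Import all_classical all_reals all_analysis.
From mathcomp Require Import zify ring lra.

Set Implicit Arguments.
Unset Strict Implicit.
Unset Printing Implicit Defensive.

Import Order.TTheory GRing.Theory Num.Theory.
Import numFieldNormedType.Exports.

Local Open Scope classical_set_scope.
Local Open Scope ring_scope.

(* Fix a real h below the entropy of X at some scale. A horseshoe is a family of
   at least exp (h n) orbit segments of length n (the letters), pairwise far
   apart at more times than can be blamed on mistakes, such that every infinite
   sequence of letters, preceded by one common initial pattern w of length 2n,
   is followed by a genuine orbit. The letters are chosen greedily, also far
   apart from each of the n + 1 shifts of w; the entropy bound leaves room for
   these additional constraints.
   A point following w and then letters is nonrecurrent: a late time at which its
   orbit returned near its starting point would make a complete letter follow a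
   shift of w. A Bowen ball determines the letters followed by the points it
   contains, so Kraft's inequality bounds below the sums in the definition of
   the entropy of the set of these points.
   Almost specification realizes all sequences of letters directly, and mistakes
   have subexponential cost. Under shadowing the letters are loops at a single
   cell of a fine partition: if there were too few loops at every cell, cutting
   orbits at the last visits to cells would give too small a cover of X. *)

Lemma lte_between (R : realType) (a : R) (x : \bar R) : (a%:E < x)%E ->
  exists2 b, a < b & (b%:E < x)%E.
Proof.
case: x => [r| |]//.
  by rewrite lte_fin => ar; exists ((a + r) / 2); rewrite ?lte_fin; lra.
by move=> _; exists (a + 1); rewrite ?ltry//; lra.
Qed.

(** * Monotonicity of the entropy in the set and the scale *)

Section Entropy.
Context {R : realType} {X : metricType R} (f : X -> X).
Implicit Types (E F : set X) (t sigma : R).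

Lemma entropy_sum_ge0 E t n sigma : (0 <= entropy_sum f E t n sigma)%E.
Proof.
apply/le_ereal_inf_tmp => _ [C _ <-].
by apply: esum_ge0 => p _; rewrite lee_fin expR_ge0.
Qed.

Lemma entropy_sumS E F t n sigma : E `<=` F ->
  (entropy_sum f E t n sigma <= entropy_sum f F t n sigma)%E.
Proof.
move=> EF; apply/le_ereal_inf_tmp => _ [C [cC [nC FC]] <-].
apply: ereal_inf_lbound; exists C => //; split=> //; split=> //.
exact: subset_trans FC.
Qed.

Lemma nondecreasing_entropy_sum E t sigma :
  nondecreasing_seq (fun n => entropy_sum f E t n sigma).
Proof.
move=> m n mn; apply/le_ereal_inf_tmp => _ [C [cC [nC FC]] <-].
apply: ereal_inf_lbound; exists C => //; split=> //; split=> // p /nC.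
exact: leq_trans.
Qed.

Lemma nonincreasing_entropy_sum E t n sigma tau : sigma <= tau ->
  (entropy_sum f E t n tau <= entropy_sum f E t n sigma)%E.
Proof.
move=> st; apply/le_ereal_inf_tmp => _ [C [cC [nC FC]] <-].
apply: ereal_inf_lbound; exists C => //; split=> //; split=> // x /FC[p Cp xp].
by exists p => //; exact: lt_le_trans st.
Qed.

Lemma entropy_measureE E t sigma : entropy_measure f E t sigma =
  ereal_sup (range (fun n => entropy_sum f E t n sigma)).
Proof.
apply/cvg_lim => //; apply: ereal_nondecreasing_cvgn.
exact: nondecreasing_entropy_sum.
Qed.

Lemma entropy_sum_le_measure E t n sigma :
  (entropy_sum f E t n sigma <= entropy_measure f E t sigma)%E.
Proof. by rewrite entropy_measureE; apply: ereal_sup_ubound; exists n. Qed.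

Lemma entropy_measure_eq0S E F t sigma tau : E `<=` F -> sigma <= tau ->
  entropy_measure f F t sigma = 0%E -> entropy_measure f E t tau = 0%E.
Proof.
move=> EF st; rewrite !entropy_measureE => F0.
apply/eqP; rewrite eq_le; apply/andP; split; last first.
  apply: le_trans (entropy_sum_ge0 E t 0 tau) _.
  by apply: ereal_sup_ubound; exists 0%N.
rewrite -F0; apply: ge_ereal_sup => _ [n _ <-].
apply: le_trans (nonincreasing_entropy_sum E t n st) _.
apply: le_trans (entropy_sumS t n sigma EF) _.
by apply: ereal_sup_ubound; exists n.
Qed.

Lemma htop_scaleS E F sigma tau : E `<=` F -> sigma <= tau ->
  (htop_scale f E tau <= htop_scale f F sigma)%E.
Proof.
move=> EF st; apply: le_ereal_inf => _ [t [t0 Ft] <-].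
exists t => //; split=> //; exact: entropy_measure_eq0S Ft.
Qed.

Lemma htop_scale_ge0 E sigma : (0 <= htop_scale f E sigma)%E.
Proof. by apply/le_ereal_inf_tmp => _ [t [t0 _] <-]; rewrite lee_fin. Qed.

(** Finer scales have larger entropy, so the limit at 0 is a supremum. *)
Lemma htopE E : htop f E = ereal_sup (htop_scale f E @` [set s | 0 < s]).
Proof.
apply/cvg_lim => //.
rewrite (_ : [set s | 0 < s] = [set` Interval (BRight (0 : R)) +oo%O]).
  by apply: nonincreasing_at_right_cvge => // s r _ _ sr; apply: htop_scaleS.
by apply/seteqP; split=> s /=; rewrite in_itv/= andbT.
Qed.

Lemma htop_scale_le_htop E sigma : 0 < sigma ->
  (htop_scale f E sigma <= htop f E)%E.
Proof. by move=> s0; rewrite htopE; apply: ereal_sup_ubound; exists sigma. Qed.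

Lemma htopS E F : E `<=` F -> (htop f E <= htop f F)%E.
Proof.
move=> EF; rewrite htopE; apply: ge_ereal_sup => _ [s s0 <-].
by apply: le_trans (htop_scale_le_htop F s0); exact: htop_scaleS.
Qed.

Lemma htop_scale_ge E t sigma :
  (forall s, 0 <= s -> s < t -> entropy_measure f E s sigma <> 0%E) ->
  (t%:E <= htop_scale f E sigma)%E.
Proof.
move=> Et; apply/le_ereal_inf_tmp => _ [s [s0 Es] <-].
by rewrite lee_fin leNgt; apply/negP => st; exact: Et Es.
Qed.

End Entropy.

(** * Patterns, finite nets and small covers *)

Section Covers.
Context {R : realType} {X : metricType R} (f : X -> X).
Implicit Types (p q : nat -> X) (c : R).

Definition orbit_seq (x : X) : nat -> X := fun i => iter i f x.

(** Patterns are arbitrary sequences, as altered or glued orbit segments need not be orbits.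
    Shadowing will make this set of bad times empty, almost specification only small. *)
Definition mistakes n c p q : {set 'I_n} :=
  [set i : 'I_n | c < mdist (p i) (q i)]%SET.

Lemma expR_ge_nat (a b : R) : 0 < a ->
  exists N, forall n, (N <= n)%N -> b <= expR (a * n%:R).
Proof.
move=> a0; exists (Num.trunc (b / a)).+1 => n Nn.
apply: le_trans (expR_ge1Dx _).
have : b / a < n%:R by apply: lt_le_trans (truncnS_gt _) _; rewrite ler_nat.
rewrite ltr_pdivrMr// => /ltW ban; rewrite mulrC; apply: le_trans ban _.
by rewrite lerDr.
Qed.

Lemma finite_net (delta : R) : compact [set: X] -> 0 < delta ->
  exists m (c : X -> 'I_m) (y : 'I_m -> X), forall x, mdist (y (c x)) x < delta.
Proof.
move=> cX d0.
have [s sP] : exists s : seq X, forall x, exists2 y, y \in s & mdist y x < delta.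
  apply: contrapT => /forallNP nos.
  (* Without a finite net these sets form a filter base, whose cluster point [p] is refuted by the
     list [[:: p]]. *)
  pose B (s : seq X) := [set x | forall y, y \in s -> delta <= mdist y x].
  have FB : ProperFilter (filter_from [set: seq X] B).
    apply: filter_from_proper; last first.
      move=> s _; have /existsNP[x xs] := nos s; exists x => y ys.
      by rewrite leNgt; apply/negP => yx; apply: xs; exists y.
    apply: filter_from_filter; first by exists [::].
    move=> s r _ _; exists (s ++ r) => // x xB; split=> y ys; apply: xB;
      by rewrite mem_cat ys ?orbT.
  have [|p [_ pcl]] := cX _ FB; first by exists [::].
  have [||x [xB]] := pcl (B [:: p]) (ball p delta).
  - by exists [:: p].
  - exact: nbhsx_ballx.
  - by rewrite ballEmdist/= ltNge xB// inE.
pose g x := sval (cid2 (sP x)).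
have gs x : (index (g x) s < size s)%N by rewrite index_mem /g; case: cid2.
case: (eqVneq (size s) 0%N) => [s0|].
  suff X0 : X -> False.
    by exists 0%N, (fun x => False_rect _ (X0 x)), 
      (fun i : 'I_0 => False_rect X (notF (ltn_ord i))) => x; case: (X0 x).
  by move=> x; have := gs x; rewrite s0.
case: s sP @g gs => // a s sP g gs _.
exists (size (a :: s)), (fun x => Ordinal (gs x)), (fun i => nth a (a :: s) i).
by move=> x; rewrite nth_index /g; case: cid2.
Qed.

Lemma esum_seq_le (T : choiceType) (s : seq T) (a : T -> \bar R) (b : R) : 0 <= b ->
  (forall t, (0 <= a t <= b%:E)%E) ->
  (\esum_(t in [set` s]) a t <= ((size s)%:R * b)%:E)%E.
Proof.
move=> b0 ab; rewrite (_ : [set` s] = [set` undup s]); last first.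
  by apply/seteqP; split=> t /=; rewrite mem_undup.
rewrite esum_fset//; last by move=> i _; case/andP: (ab i).
rewrite -fsbig_seq ?undup_uniq//.
apply: (@le_trans _ _ (\sum_(t <- undup s) b%:E)%E).
  by apply: lee_sum => t _; case/andP: (ab t).
rewrite sumEFin lee_fin big_const_seq count_predT iter_addr_0 -[leLHS]mulr_natl.
by apply: ler_wpM2r => //; rewrite ler_nat size_undup.
Qed.

Lemma mistakes0P n c p q :
  reflect (forall i, (i < n)%N -> mdist (p i) (q i) <= c) (mistakes n c p q == finset.set0).
Proof.
apply: (iffP eqP) => [pq0 i ni|pq].
  have := finset.in_set0 (Ordinal ni); rewrite -pq0 inE/= => /negbT.
  by rewrite -leNgt.
by apply/setP => i; rewrite !inE ltNge pq.
Qed.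

Lemma mdist_triangle_sym (x y z : X) : mdist x y <= mdist x z + mdist y z.
Proof. by rewrite (metric_sym y); exact: metric_triangle. Qed.

Lemma htop_scale_gt_sum E h sigma : (h%:E < htop_scale f E sigma)%E -> 0 <= h ->
  exists t c n0, [/\ h < t, 0 < c &
    forall n, (n0 <= n)%N -> (c%:E <= entropy_sum f E t n sigma)%E].
Proof.
move=> hE h0.
have [t ht tE] := lte_between hE.
have Et0 : entropy_measure f E t sigma <> 0%E.
  move=> Et; move: tE; rewrite ltNge => /negP; apply.
  by apply: ereal_inf_lbound; exists t => //; split=> //; apply: ltW; lra.
have : (0 < entropy_measure f E t sigma)%E.
  rewrite lt_neqAle eq_sym; apply/andP; split; first exact/eqP.
  exact: le_trans (entropy_sum_ge0 f E t 0 sigma) (entropy_sum_le_measure _ _ _ _ _).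
rewrite entropy_measureE => /ereal_sup_gt[_ [n0 _ <-] s0].
have [c c0 cs] : exists2 c : R, 0 < c & (c%:E <= entropy_sum f E t n0 sigma)%E.
  case: (entropy_sum f E t n0 sigma) s0 => [r| |]//.
    by rewrite lte_fin => r0; exists r.
  by exists 1; rewrite ?leey.
exists t, c, n0; split=> // n n0n.
by apply: le_trans cs _; exact: nondecreasing_entropy_sum.
Qed.

(** Patterns that catch every orbit up to rho yield no more Bowen balls of order n and radius sigma
    > 2 rho. If there are at most exp (h n) of them, their sum at an exponent t > h tends to 0. *)
Lemma no_small_cover (h sigma rho : R) : (h%:E < htop_scale f [set: X] sigma)%E ->
  0 <= h -> 0 < sigma -> rho + rho < sigma ->
  exists N, forall n, (N <= n)%N -> forall L : seq (nat -> X),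
    (size L)%:R <= expR (h * n%:R) ->
    exists x, forall p, p \in L -> mistakes n rho (orbit_seq x) p != finset.set0.
Proof.
move=> hX h0 s0 rs.
have [t [c [n0 [ht c0 cn]]]] := htop_scale_gt_sum hX h0.
have [|N1 N1P] := @expR_ge_nat (t - h) (2 / c); first by rewrite subr_gt0.
exists (maxn n0 N1) => n; rewrite geq_max => /andP[n0n N1n] L sL.
apply: contrapT => /forallNP noL.
pose close p x := mistakes n rho (orbit_seq x) p == finset.set0.
(* A ball is centred at a point whose orbit is close to the pattern; patterns without such a point
   are dropped. *)
pose g p := if pselect (exists x, close p x) is left e
  then Some (sval (cid e), n) else None.
pose C : set (X * nat) := [set` pmap g L].
have Cn u : C u -> u.2 = n.
  rewrite /C; case: u => x k /=; rewrite mem_pmap => /mapP[p _]; rewrite /g.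
  by case: pselect => // e [_ ->].
have CX : bowen_covers f [set: X] n sigma C.
  split; first by apply: finite_set_countable; exact: finite_seq.
  split; first by move=> p /Cn ->.
  move=> x _; have /existsNP[p /not_implyP[pL /negP]] := noL x.
  rewrite negbK => xp.
  have ep : exists x, close p x by exists x.
  have [y gp yp] : exists2 y, g p = Some (y, n) & close p y.
    by rewrite /g; case: pselect => // e; exists (sval (cid e)) => //; case: cid.
  exists (y, n).
    by rewrite /C/= mem_pmap -gp; apply/mapP; exists p.
  rewrite /bowen_ball/= /bowen_dist; apply/bigmax_ltP; split=> // i _.
  apply: le_lt_trans (mdist_triangle_sym _ _ (p i)) _.
  apply: le_lt_trans rs; apply: lerD.
    by move: yp => /mistakes0P/(_ _ (ltn_ord i)).
  by move: xp => /mistakes0P/(_ _ (ltn_ord i)).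
have Csum : (entropy_sum f [set: X] t n sigma <=
    ((size (pmap g L))%:R * expR (- (t * n%:R)))%:E)%E.
  apply: (@le_trans _ _ (\esum_(p in C) (expR (- (t * p.2%:R)))%:E)%E).
    by apply: ereal_inf_lbound; exists C.
  rewrite (@eq_esum _ _ _ _ (fun=> (expR (- (t * n%:R)))%:E)).
    by apply: esum_seq_le => [|_]; rewrite ?lee_fin ?expR_ge0 ?lexx.
  by move=> p /Cn ->.
have := le_trans (cn n n0n) Csum; rewrite lee_fin; apply/negP; rewrite -ltNge.
apply: (@le_lt_trans _ _ (expR (h * n%:R) * expR (- (t * n%:R)))).
  apply: ler_wpM2r; first exact: expR_ge0.
  apply: le_trans sL; rewrite ler_nat size_pmap.
  exact: count_size.
rewrite -expRD -[_ + _]opprK opprD opprK -mulNr -mulrDl expRN.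
rewrite (addrC (- h)) invf_plt ?posrE ?expR_gt0//.
apply: lt_le_trans (N1P _ N1n).
by rewrite -[ltLHS]mul1r ltr_pM2r ?invr_gt0//; lra.
Qed.

End Covers.

(** * Kraft's inequality *)

Section Kraft.
Context {R : realType} {T : choiceType} (A : nat) (C : set T).
Context (V : T -> nat -> 'I_A) (len : T -> nat).

Let weight (p : T) : R := A%:R ^- len p.
Let below (w : seq 'I_A) (p : T) :=
  (w == mkseq (V p) (size w)) && (size w <= len p)%N.
Let mass (w : seq 'I_A) : \bar R :=
  (\esum_(p in C) if below w p then (weight p)%:E else 0)%E.

(** The codeword of [p] is the prefix of [V p] of length [len p]; [mass w] adds the weights of the
    codewords extending [w]. If the total were below 1, letters could be added one by one, keeping
    the mass of each prefix of length k below A ^- k. The resulting sequence has a codeword as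
    prefix, which alone contributes that much. *)
Lemma kraft : (0 < A)%N ->
  (forall s : nat -> 'I_A,
    exists2 p, C p & forall l, (l < len p)%N -> s l = V p l) ->
  (1%:E <= \esum_(p in C) (A%:R ^- len p)%:E :> \bar R)%E.
Proof.
move=> A0 cov; rewrite leNgt; apply/negP => lt1.
have AR0 : 0 < A%:R :> R by rewrite ltr0n.
have w0 p : 0 <= weight p by rewrite /weight invr_ge0 exprn_ge0// ltW.
have step w : exists a, (mass w < (A%:R ^- size w)%:E)%E ->
    (mass (rcons w a) < (A%:R ^- (size w).+1)%:E)%E.
  have [lt|_] := ltP; last by exists (Ordinal A0).
  apply: contrapT => /forallNP big.
  have {}big a : ((A%:R ^- (size w).+1)%:E <= mass (rcons w a))%E.
    by rewrite leNgt; apply/negP => am; apply: (big a).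
  move: lt; apply/negP; rewrite -leNgt.
  (* Codewords strictly longer than [w] are divided among its A extensions. *)
  apply: (@le_trans _ _ (\sum_(a < A) mass (rcons w a))%E).
    apply: (@le_trans _ _ (\sum_(a < A) (A%:R ^- (size w).+1)%:E)%E); last first.
      exact: lee_sum.
    rewrite sumEFin lee_fin sumr_const card_ord -[leRHS]mulr_natl exprS invfM.
    by rewrite mulrA divff ?mul1r// gt_eqF.
  rewrite /mass -esum_sum; last by move=> p a _ _; case: ifP; rewrite ?lee_fin.
  apply: le_esum => p _.
  rewrite (bigD1 (V p (size w)))//= big1 ?adde0; last first.
    move=> a /negPf aV; rewrite /below size_rcons mkseqS eqseq_rcons aV.
    by rewrite andbF.
  rewrite /below size_rcons mkseqS eqseq_rcons eqxx andbT.
  case: eqP => //= _; case: ltnP => [/ltnW ->//|_].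
  by case: ifP; rewrite ?lee_fin.
pose pick w := sval (cid (step w)).
have pickP w : (mass w < (A%:R ^- size w)%:E)%E ->
    (mass (rcons w (pick w)) < (A%:R ^- (size w).+1)%:E)%E.
  by rewrite /pick; case: cid.
pose word := fix word k := if k is k'.+1 then rcons (word k') (pick (word k'))
  else [::].
pose s k := pick (word k).
have wordE k : word k = mkseq s k.
  by elim: k => // k IH; rewrite mkseqS -IH.
have massk k : (mass (mkseq s k) < (A%:R ^- k)%:E)%E.
  elim: k => [|k IH].
    rewrite expr0 invr1; apply: le_lt_trans lt1; apply: le_esum => p _.
    by rewrite /below /=.
  have := @pickP (mkseq s k); rewrite size_mkseq => /(_ IH).
  by rewrite mkseqS /s wordE.
have [p Cp sp] := cov s.
have := massk (len p); apply/negP; rewrite -leNgt.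
apply: esum_ge; exists [set p]; first by split=> // _ ->.
rewrite fsbig_set1 /below size_mkseq leqnn andbT ifT//.
by apply/eqP/eq_in_map => l; rewrite mem_iota => /andP[_] /sp.
Qed.

End Kraft.

(** * Horseshoes bound the entropy of nonrecurrent points *)

Section Horseshoe.
Context {R : realType} {X : metricType R} (f : X -> X).
Implicit Types (p q : nat -> X) (c : R).

Lemma near_orbit (m : nat) (eps : R) (z : X) : continuous f -> 0 < eps ->
  \forall y \near z, forall i, (i < m)%N -> mdist (iter i f z) (iter i f y) < eps.
Proof.
move=> cf e0; elim: m => [|m IH]; first by near=> y.
have cm : {for z, continuous (iter m f)}.
  elim: m {IH} => [|m IH]; first exact: cvg_id.
  by move=> /=; apply: continuous_comp => //; apply: cf.
have mz : \forall y \near z, mdist (iter m f z) (iter m f y) < eps.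
  have := cm (ball (iter m f z) eps) (nbhsx_ballx _ _ e0).
  by rewrite ballEmdist.
near=> y => i; rewrite ltnS leq_eqVlt => /orP[/eqP ->|]; first by near: y.
by move: i; near: y.
Unshelve. all: by end_near. Qed.

Lemma leq_mistakes n c c1 c2 p q p1 q1 p2 q2 :
  (forall i, (i < n)%N -> c < mdist (p i) (q i) ->
     c1 < mdist (p1 i) (q1 i) \/ c2 < mdist (p2 i) (q2 i)) ->
  (#|mistakes n c p q| <= #|mistakes n c1 p1 q1| + #|mistakes n c2 p2 q2|)%N.
Proof.
move=> H; apply: leq_trans (leq_card_setU _ _).
by apply: subset_leq_card; apply/fintype.subsetP => i; rewrite !inE => /(H _ (ltn_ord i))/orP.
Qed.

Lemma mistakes_shift k n m c p q : (k + n <= m)%N ->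
  (#|mistakes n c (fun i => p (k + i)%N) (fun i => q (k + i)%N)|
     <= #|mistakes m c p q|)%N.
Proof.
move=> knm; have lt (i : 'I_n) : (k + i < m)%N by have := ltn_ord i; lia.
rewrite -(card_imset _ (_ : injective (fun i => Ordinal (lt i)))); last first.
  by move=> i j /(congr1 val)/= /addnI ij; apply: val_inj.
by apply: subset_leq_card; apply/fintype.subsetP => _ /imsetP[i + ->]; rewrite !inE.
Qed.

(** The pattern [w] fills two blocks of length n, so the letter [s j] starts at time (j + 2) n. *)
Definition follows (n r A : nat) (eps : R) (w : nat -> X)
    (e : 'I_A -> nat -> X) (s : nat -> 'I_A) (z : X) : Prop :=
  (#|mistakes (2 * n) eps (orbit_seq f z) w| <= r)%N /\
  forall j, (#|mistakes n eps (orbit_seq f (iter (j.+2 * n) f z)) (e (s j))| <= r)%N.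

(** Letters followed within eps by points 2 eps apart are at most 4 eps apart; a letter and a shift
    of [w] followed by points eps apart, at most 3 eps. Two followings allow 2 r exceptions. A shift
    by at most n leaves n of the 2 n entries of [w]. *)
Definition horseshoe (n r A : nat) (eps : R) (w : nat -> X)
    (e : 'I_A -> nat -> X) : Prop :=
  [/\ (0 < n)%N, forall s, exists z, follows n r eps w e s z,
    forall a b, a != b -> (2 * r < #|mistakes n (4 * eps) (e a) (e b)|)%N &
    forall a k, (k <= n)%N ->
      (2 * r < #|mistakes n (3 * eps) (e a) (fun i => w (k + i)%N)|)%N].

Section Theory.
Context (n r A : nat) (eps : R) (w : nat -> X) (e : 'I_A -> nat -> X).
Context (cf : continuous f) (eps0 : 0 < eps) (hs : horseshoe n r eps w e).

(* A return of z close to itself makes the next complete letter e (s j) shadow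
   a shift of the initial pattern w, which [horseshoe] forbids. *)
Lemma follows_NRec s z : follows n r eps w e s z -> NRec f z.
Proof.
have [n0 _ _ ew] := hs; move=> [zw ze] rec.
have [|y [[k /= nk ->] kz]] := rec (2 * n)%N _ _ (near_orbit (2 * n) z cf eps0).
  by rewrite /= muln_gt0.
(* Block [q] is the first to start at or after the return time k; as q >= 2 it carries a letter. It
   starts [i0] < n steps after the return, which selects the shift of [w]. *)
pose q := ((k + n.-1) %/ n)%N.
have q2 : (2 <= q)%N by rewrite /q leq_divRL//; lia.
have kq : (k <= q * n)%N by by have := ltn_ceil (k + n.-1) n0; rewrite -/q mulSn; lia.
have qk : (q * n <= k + n.-1)%N by exact: leq_trunc_div.
pose i0 := (q * n - k)%N.
have := ew (s q.-2) i0; rewrite ltnNge => /(_ _)/negP; apply; first by rewrite /i0; lia.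
apply: (@leq_trans (#|mistakes n eps (orbit_seq f (iter (q.-2.+2 * n) f z)) (e (s q.-2))| +
   #|mistakes n eps (fun i => orbit_seq f z (i0 + i)%N) (fun i => w (i0 + i)%N)|)); last first.
  rewrite mul2n -addnn; apply: leq_add; first exact: ze.
  by apply: leq_trans zw; apply: mistakes_shift; rewrite /i0; lia.
apply: leq_mistakes => i ni; case: (ltP eps) => [|h1]; first by left.
case: (ltP eps) => [|h2 h3]; first by right.
have := kz (i0 + i)%N; rewrite -iterD => /(_ _)/wrap[]; first by rewrite /i0; lia.
move: h1; rewrite /orbit_seq -iterD; have -> : (q.-2.+2 = q)%N by lia.
have -> : (i0 + i + k = i + q * n)%N by rewrite /i0; lia.
move: h2; rewrite /orbit_seq.
set a := iter _ f z; set b := iter _ f z => aw be ab.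
have := mdist_triangle_sym (e (s q.-2) i) (w (i0 + i)%N) a.
have := mdist_triangle_sym (e (s q.-2) i) a b.
move: h3 be aw ab; rewrite (metric_sym b) (metric_sym a (w _)); lra.
Qed.

(** When neither point errs the two letters are within 4 eps, so distinct letters would need more
    than 2 r errors. The block of letter l ends at time (l + 3) n. *)
Lemma follows_inj s s' z z' u l : follows n r eps w e s z ->
  follows n r eps w e s' z' ->
  (forall i, (i < u)%N -> mdist (iter i f z) (iter i f z') <= 2 * eps) ->
  (l.+3 * n <= u)%N -> s l = s' l.
Proof.
have [n0 _ ee _] := hs; move=> [_ zs] [_ zs'] zz' lu.
apply: contrapT => /eqP /ee; apply/negP; rewrite -leqNgt.
apply: leq_trans (_ : (_ <= r + r)%N) _; last by rewrite addnn mul2n.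
apply: leq_trans (leq_add (zs l) (zs' l)).
apply: leq_mistakes => i ni; case: (ltP eps) => [|h1]; first by left.
case: (ltP eps) => [|h2 h3]; first by right.
move: h1 h2 h3; rewrite /orbit_seq.
set a := iter i f _; set b := iter i f _ => ae be eeab.
have ab : mdist a b <= 2 * eps by rewrite /a /b -!iterD; apply: zz'; lia.
have := mdist_triangle_sym (e (s l) i) (e (s' l) i) a.
have := metric_triangle a b (e (s' l) i).
by move: ae; rewrite (metric_sym a (e (s l) i)) (metric_sym (e (s' l) i) a); lra.
Qed.

(** The chosen points [Z s] are nonrecurrent, so the balls of a cover of [NRec f] give codewords
    that catch every sequence [s], as Kraft's inequality requires. *)
Lemma horseshoe_entropy h : expR (h * n%:R) <= A%:R ->
  (h%:E <= htop_scale f (NRec f) eps)%E.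
Proof.
have [n0 zP _ _] := hs; move=> hA.
have A0 : (0 < A)%N by rewrite -(ltr0n R); apply: lt_le_trans hA; exact: expR_gt0.
apply: htop_scale_ge => t t0 th.
suff [N NP] : exists N, (1%:E <= entropy_sum f (NRec f) t N eps)%E.
  have := le_trans NP (entropy_sum_le_measure f _ t N eps).
  by move=> /[swap] ->; rewrite lee_fin ler10.
have ht0 : 0 < h - t by lra.
(* A ball of order u fixes letters of total length at least u - 3 n, and beyond this threshold h (u
   - 3 n) >= t u. *)
exists (Num.trunc (h * (3 * n)%:R / (h - t))).+1.
apply/le_ereal_inf_tmp => _ [C [_ [NC CE]] <-].
pose Z s := sval (cid (zP s)).
have ZP s : follows n r eps w e s (Z s) by rewrite /Z; case: cid.
pose hits (p : X * nat) s := bowen_ball f p.2 p.1 eps (Z s).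
(* Balls without chosen points get an arbitrary sequence. *)
pose V (p : X * nat) := if pselect (exists s, hits p s) is left ex
  then sval (cid ex) else (fun=> Ordinal A0).
(* The two blocks of [w] carry no letter. *)
pose len (p : X * nat) := (p.2 %/ n - 2)%N.
apply: le_trans (_ : (\esum_(p in C) (A%:R ^- len p)%:E <= _)%E); last first.
  apply: le_esum => p /NC Np; rewrite lee_fin expRN.
  rewrite lef_pV2 ?posrE ?expR_gt0 ?exprn_gt0 ?ltr0n//.
  apply: le_trans (_ : _ <= expR (h * n%:R) ^+ len p) _; last first.
    by apply: lerXn2r => //; rewrite nnegrE ?expR_ge0// ler0n.
  rewrite -expRM_natl ler_expR.
  have : (p.2 <= len p * n + 3 * n)%N.
    by rewrite /len; have := divn_eq p.2 n; have := ltn_pmod p.2 n0; nia.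
  rewrite -(ler_nat R) natrD natrM => lenp.
  have : h * (3 * n)%:R / (h - t) < p.2%:R.
    by apply: lt_le_trans (truncnS_gt _) _; rewrite ler_nat.
  rewrite ltr_pdivrMr// => hp; have h0 : 0 <= h by lra.
  have := ler_wpM2l h0 lenp; rewrite mulrDr => H.
  lra.
apply: kraft => // s.
have [p Cp ps] := CE (Z s) (follows_NRec (ZP s)).
have ps' : hits p (V p).
  by rewrite /V; case: pselect => [ex|[]]; [exact: svalP (cid ex)|exists s].
exists p => // l lp.
apply: (@follows_inj s (V p) (Z s) (Z (V p)) p.2 l (ZP s) (ZP _)).
  move=> i ip; apply: le_trans (mdist_triangle_sym _ _ (iter i f (fst p))) _.
  move: ps ps'; rewrite /hits /bowen_ball/= /bowen_dist.
  move=> /bigmax_ltP[_ /(_ (Ordinal ip) isT) /= h1].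
  move=> /bigmax_ltP[_ /(_ (Ordinal ip) isT) /= h2].
  by rewrite !(metric_sym _ (iter i f p.1)); lra.
rewrite /len in lp; apply: leq_trans (leq_trunc_div p.2 n).
by rewrite leq_mul2r; lia.
Qed.

End Theory.

End Horseshoe.

(** * Greedy choice of letters *)

Section Letters.
Context {R : realType} {X : metricType R} (f : X -> X).
Implicit Types (p q : nat -> X) (c : R).

Lemma mistakesC n c p q : mistakes n c p q = mistakes n c q p.
Proof. by apply/setP => i; rewrite !inE metric_sym. Qed.

Lemma mistakes_sub n c c' p q : c <= c' ->
  (#|mistakes n c' p q| <= #|mistakes n c p q|)%N.
Proof.
move=> cc; apply: subset_leq_card; apply/fintype.subsetP => i; rewrite !inE.
exact: le_lt_trans.
Qed.

Lemma greedy_letters (Q : X -> Prop) (n m c A : nat) (d : R) (L0 : seq (nat -> X)) :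
  (forall L : seq (nat -> X), (size L <= m)%N ->
    exists2 x, Q x & forall p, p \in L -> (c < #|mistakes n d (orbit_seq f x) p|)%N) ->
  (size L0 + A <= m.+1)%N ->
  exists e : nat -> X, forall a, (a < A)%N ->
    [/\ Q (e a), forall p, p \in L0 -> (c < #|mistakes n d (orbit_seq f (e a)) p|)%N &
        forall b, (b < a)%N ->
          (c < #|mistakes n d (orbit_seq f (e a)) (orbit_seq f (e b))|)%N].
Proof.
move=> H; elim: A => [|A IH] sA.
  by have [x _ _] := H [::] isT; exists (fun=> x).
have [|e eP] := IH; first by lia.
have [|x Qx xP] := H (L0 ++ [seq orbit_seq f (e b) | b <- iota 0 A]).
  by rewrite size_cat size_map size_iota; lia.
exists (fun a => if (a < A)%N then e a else x) => a; rewrite ltnS => aA.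
have [aA'|Aa] := ltnP a A.
  have [h1 h2 h3] := eP a aA'; split=> // b ba; rewrite (ltn_trans ba aA').
  exact: h3.
have aE : a = A by apply/eqP; rewrite eqn_leq aA.
split=> // [p pL0|b]; first by apply: xP; rewrite mem_cat pL0.
rewrite aE => bA; rewrite bA; apply: xP; rewrite mem_cat; apply/orP; right.
by apply/mapP; exists b => //; rewrite mem_iota.
Qed.

(** [Q] selects the orbits that may serve as letters, such as loops at one cell. Each choice has to
    avoid the n + 1 shifts of [w] and at most A - 1 earlier letters, hence the bound A + n. *)
Lemma horseshoe_exists (Q : X -> Prop) (n r A : nat) (eps : R) (w : nat -> X) :
  (0 < n)%N -> 0 < eps ->
  (forall L : seq (nat -> X), (size L <= A + n)%N ->
    exists2 x, Q x & forall p, p \in L ->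
      (2 * r < #|mistakes n (4 * eps) (orbit_seq f x) p|)%N) ->
  (forall e : 'I_A -> X, (forall a, Q (e a)) -> forall s,
    exists z, follows f n r eps w (fun a => orbit_seq f (e a)) s z) ->
  exists e : 'I_A -> nat -> X, horseshoe f n r eps w e.
Proof.
move=> n0 eps0 ext realize.
pose L0 := [seq (fun i => w (k + i)%N) | k <- iota 0 n.+1].
have [|e eP] := @greedy_letters Q n (A + n) (2 * r) A (4 * eps) L0 ext.
  by rewrite size_map size_iota; lia.
exists (fun a => orbit_seq f (e a)); split=> //.
- by apply: (realize (fun a : 'I_A => e a)) => a; case: (eP a (ltn_ord a)).
- move=> a b; rewrite neq_ltn => /orP[ab|ba].
    by rewrite mistakesC; case: (eP b (ltn_ord b)) => _ _; exact.
  by case: (eP a (ltn_ord a)) => _ _; exact.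
- move=> a k kn; have [_ aw _] := eP a (ltn_ord a).
  apply: leq_trans (aw (fun i => w (k + i)%N) _) _; last first.
    by apply: mistakes_sub; lra.
  by apply/mapP; exists k => //; rewrite mem_iota; lia.
Qed.

End Letters.

(** * Covers up to a sublinear number of mistakes *)

Section AlmostSpecification.
Context {R : realType} {X : metricType R} (f : X -> X).
Implicit Types (p : nat -> X).

(** A Chernoff bound: with weight exp (- kappa) per mark, all maps together weigh (1 + q exp (-
    kappa)) ^ n, while a map with at most m marks weighs at least exp (- kappa m). *)
Lemma card_few_marked (n m q : nat) (kappa : R) : 0 <= kappa ->
  #|[set phi : {ffun 'I_n -> 'I_q.+1} | (#|[set i | phi i != ord0]%SET| <= m)%N]%SET|%:R
    <= expR (kappa * m%:R + n%:R * (q%:R * expR (- kappa))) :> R.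
Proof.
move=> k0.
pose wt (o : 'I_q.+1) : R := if o == ord0 then 1 else expR (- kappa).
have wt0 o : 0 <= wt o by rewrite /wt; case: ifP => // _; exact: expR_ge0.
rewrite expRD mulrC -ler_pdivrMr ?expR_gt0// -expRN.
apply: (@le_trans _ _ (\sum_(phi : {ffun 'I_n -> 'I_q.+1}) \prod_i wt (phi i))).
  rewrite [leRHS](bigID [in [set phi : {ffun 'I_n -> 'I_q.+1} |
      (#|[set i | phi i != ord0]%SET| <= m)%N]%SET])/=.
  apply: ler_wpDr; first by apply: sumr_ge0 => phi _; apply: prodr_ge0.
  rewrite mulr_natl -sumr_const; apply: ler_sum => phi; rewrite inE => few.
  rewrite (bigID [pred i | phi i == ord0])/= big1 ?mul1r; last first.
    by move=> i /eqP pi0; rewrite /wt pi0 eqxx.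
  rewrite (eq_bigr (fun=> expR (- kappa))); last first.
    by move=> i /negPf pi0; rewrite /wt pi0.
  rewrite prodr_const -expRM_natl ler_expR mulrN lerN2 mulrC.
  apply: ler_wpM2l => //; rewrite ler_nat; apply: leq_trans few.
  by apply: eq_leq; apply: eq_card => i; rewrite !inE.
rewrite -(bigA_distr_bigA (fun=> wt))/=.
rewrite prodr_const card_ord expRM_natl; apply: lerXn2r; rewrite ?nnegrE ?expR_ge0 ?sumr_ge0//.
apply: le_trans (expR_ge1Dx _).
rewrite big_ord_recl /wt eqxx lerD2l (eq_bigr (fun=> expR (- kappa))).
  by rewrite sumr_const card_ord mulr_natl.
by [].
Qed.

(* A pattern followed with at most m mistakes is followed exactly by one of
   the patterns obtained from it by changing at most m entries to points of a
   finite net. *)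
Lemma no_small_mistake_cover (h rho sigma eta : R) (m : nat -> nat) :
  compact [set: X] ->
  (h%:E < htop_scale f [set: X] sigma)%E -> 0 <= h -> 0 < rho ->
  rho + rho < sigma -> 0 < eta -> eta <= h ->
  (forall d : R, 0 < d -> exists N, forall n, (N <= n)%N -> (m n)%:R <= d * n%:R :> R) ->
  exists N, forall n, (N <= n)%N -> forall L : seq (nat -> X),
    (size L)%:R <= expR ((h - eta) * n%:R) ->
    exists x, forall p, p \in L -> (m n < #|mistakes n rho (orbit_seq f x) p|)%N.
Proof.
move=> cX hX h0 rho0 rs eta0 etah mP.
have [q [c [y yP]]] := finite_net cX rho0.
have [|N0 N0P] := no_small_cover hX h0 _ rs; first by lra.
(* [kappa] makes q exp (- kappa) at most eta / 2; for n large kappa (m n) is at most (eta / 2) n, so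
   there are at most exp (eta n) alterations. *)
have [k1 k1P] := @expR_ge_nat _ 1 (2 * q%:R / eta) ltr01.
pose kappa : R := k1.+1%:R.
have k0 : 0 < kappa by rewrite ltr0n.
have qk : q%:R * expR (- kappa) <= eta / 2.
  rewrite expRN ler_pdivrMr ?expR_gt0//.
  have := k1P k1.+1 (leqnSn _); rewrite mul1r -/kappa.
  rewrite ler_pdivrMr//; lra.
have [|N1 N1P] := mP (eta / 2 / kappa); first by rewrite !divr_gt0.
exists (maxn N0 N1) => n; rewrite geq_max => /andP[N0n N1n] L sL.
pose few := [set phi : {ffun 'I_n -> 'I_q.+1} | (#|[set i | phi i != ord0]%SET| <= m n)%N]%SET.
(* The value [ord0] keeps the entry; any other replaces it by a net point. *)
pose alter p (phi : {ffun 'I_n -> 'I_q.+1}) : nat -> X := fun i =>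
  if insub i is Some i' then
    if unlift ord0 (phi i') is Some j then y j else p i
  else p i.
have [|x xP] := N0P n N0n [seq alter p phi | p <- L, phi <- enum few].
  rewrite size_allpairs -cardE natrM.
  apply: le_trans (ler_pM _ _ sL (card_few_marked n (m n) q (ltW k0))) _ => //.
  rewrite -expRD ler_expR.
  have : kappa * (m n)%:R <= eta / 2 * n%:R.
    have := N1P _ N1n => /(ler_wpM2l (ltW k0)); congr (_ <= _).
    by field; rewrite gt_eqF.
  have : n%:R * (q%:R * expR (- kappa)) <= n%:R * (eta / 2) by exact: ler_wpM2l.
  lra.
exists x => p pL; rewrite ltnNge; apply/negP => xp.
pose phi := [ffun i : 'I_n => if i \in mistakes n rho (orbit_seq f x) p
  then lift ord0 (c (iter i f x)) else ord0].
have phiE i : (phi i != ord0) = (i \in mistakes n rho (orbit_seq f x) p).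
  by rewrite ffunE; case: ifP => _; rewrite ?eqxx// eq_sym neq_lift.
have /xP : alter p phi \in [seq alter p phi | p <- L, phi <- enum few].
  apply: allpairs_f => //; rewrite mem_enum inE; apply: leq_trans xp.
  by apply: eq_leq; apply: eq_card => i; rewrite inE phiE.
apply/negP; rewrite negbK; apply/mistakes0P => i ni.
rewrite /alter insubT /= ffunE; case: ifPn => [_|].
  by rewrite liftK metric_sym ltW.
by rewrite unlift_none inE -leNgt.
Qed.

(** Exceeding eps is an open condition, so the mistakes of the cluster point are shared by all
    nearby [u M]. *)
Lemma mistakes_cluster (n r k : nat) (eps : R) p (u : nat -> X) z :
  continuous f -> cluster (u @ \oo) z ->
  (exists N, forall M, (N <= M)%N ->
    (#|mistakes n eps (orbit_seq f (iter k f (u M))) p| <= r)%N) ->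
  (#|mistakes n eps (orbit_seq f (iter k f z)) p| <= r)%N.
Proof.
move=> cf zu [N NP].
have nz : \forall y \near z, forall i : 'I_n, eps < mdist (iter i f (iter k f z)) (p i) ->
    eps < mdist (iter i f (iter k f y)) (p i).
  apply: filter_forall => i.
  have [le|gt] := leP (mdist (iter i f (iter k f z)) (p i)) eps; first by near=> y.
  have d0 : 0 < mdist (iter i f (iter k f z)) (p i) - eps by lra.
  have := near_orbit (i + k).+1 z cf d0; apply: filterS => y yz _.
  have := yz (i + k)%N (ltnSn _); rewrite !iterD => zy.
  have := metric_triangle (iter i f (iter k f z)) (iter i f (iter k f y)) (p i).
  lra.
have uN : (u @ \oo) [set u M | M in [set M | (N <= M)%N]].
  by exists N => // M /= NM; exists M.
have [_ [[M /= NM <-] Mz]] := zu _ _ uN nz.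
apply: leq_trans (NP M NM); apply: subset_leq_card; apply/fintype.subsetP => i.
by rewrite !inE; exact: Mz.
Unshelve. all: by end_near. Qed.

Lemma mistake_ball_card (g : nat -> R -> nat) n x eps y :
  mistake_ball f g n x eps y ->
  (#|mistakes n eps (orbit_seq f y) (orbit_seq f x)| <= g n eps)%N.
Proof.
move=> [L [Lg xy]]; apply: leq_trans Lg; apply: subset_leq_card.
apply/fintype.subsetP => i; rewrite !inE metric_sym; apply: contraL => iL.
by rewrite -leNgt; apply: le_trans xy; exact: le_bigmax_cond.
Qed.

End AlmostSpecification.

(** * Horseshoes from almost specification *)

Section AlmostSpecificationHorseshoe.
Context {R : realType} {X : metricType R} (f : X -> X).

Lemma expR_ge_linear (a : R) : 0 < a ->
  exists N, forall n, (N <= n)%N -> n%:R + 2 <= expR (a * n%:R).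
Proof.
move=> a0; have a20 : 0 < a / 2 by lra.
have [N NP] := expR_ge_nat (2 + 2 / a) a20.
exists N => n /NP nN; have -> : a * n%:R = a / 2 * n%:R + a / 2 * n%:R by lra.
rewrite expRD; apply: le_trans (_ : (2 + 2 / a) * (1 + a / 2 * n%:R) <= _).
  have -> : (2 + 2 / a) * (1 + a / 2 * n%:R) = 2 + n%:R + (2 / a + a * n%:R).
    by field; rewrite gt_eqF.
  have : 0 <= a * n%:R by rewrite mulr_ge0// ltW.
  have : 0 < 2 / a by rewrite divr_gt0.
  lra.
have n0 : 0 <= a / 2 * n%:R by rewrite mulr_ge0// ltW.
apply: ler_pM => //; last exact: expR_ge1Dx.
  by rewrite addr_ge0// divr_ge0// ltW.
by rewrite addr_ge0.
Qed.

Definition alphabet_size (h : R) (n : nat) : nat := (Num.trunc (expR (h * n%:R))).+1.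

Lemma alphabet_size_ge h n : expR (h * n%:R) <= (alphabet_size h n)%:R.
Proof. by apply/ltW; exact: truncnS_gt. Qed.

Lemma alphabet_size_le h n : 0 <= h ->
  (alphabet_size h n + n)%:R <= expR (h * n%:R) * (n%:R + 2).
Proof.
move=> h0; rewrite /alphabet_size natrD -addn1 natrD.
have : (Num.trunc (expR (h * n%:R)))%:R <= expR (h * n%:R).
  by have /andP[] := truncn_itv (expR_ge0 (h * n%:R)).
have : 1 <= expR (h * n%:R) by rewrite -expR0 ler_expR mulr_ge0.
have : 0 <= n%:R :> R by [].
nra.
Qed.

Lemma sum_block_lengths (n M : nat) (j : 'I_M) :
  (\sum_(s < M | (s < j)%N) (if s == 0%N :> nat then 2 * n else n)
     = if j == 0%N :> nat then 0 else j.+1 * n)%N.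
Proof.
rewrite -(big_ord_widen M (fun s => if s == 0%N then 2 * n else n)%N (ltnW (ltn_ord j))).
elim: (val j) => [|k IH]; first by rewrite big_ord0.
by rewrite big_ord_recr /= IH; case: k {IH} => //= k; lia.
Qed.

(** Specification realizes every finite initial part of the sequence, and a cluster point of the
    realizations follows all of it. *)
Lemma almost_specification_follows (g : nat -> R -> nat) (k : R -> nat)
    (n : nat) (eps : R) (x0 : X) (A : nat) (e : 'I_A -> X) (s : nat -> 'I_A) :
  compact [set: X] -> continuous f -> 0 < eps ->
  (forall (m : nat) (eps : 'I_m -> R) (x : 'I_m -> X) (n : 'I_m -> nat),
       (0 < m)%N ->
       (forall j, 0 < eps j) ->
       (forall j, (k (eps j) <= n j)%N) ->
       exists z : X, forall j : 'I_m,
         mistake_ball f g (n j) (x j) (eps j)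
           (iter (\sum_(s < m | (s < j)%N) n s)%N f z)) ->
  (k eps <= n)%N -> (g n eps <= g (2 * n)%N eps)%N ->
  exists z, follows f n (g (2 * n)%N eps) eps (orbit_seq f x0)
    (fun a => orbit_seq f (e a)) s z.
Proof.
move=> cX cf eps0 spec kn gn.
(* Segment 0 is the pattern, of length 2 n; segment j + 1 is the letter [s j] and starts at time (j
   + 2) n, as in [follows]. *)
pose x (j : nat) := if j is j'.+1 then e (s j') else x0.
pose len (j : nat) := (if j == 0%N then 2 * n else n)%N.
have finite_spec M : exists z, forall j, (j < M.+1)%N ->
    mistake_ball f g (len j) (x j) eps (iter (if j == 0%N then 0 else j.+1 * n)%N f z).
  have [||z zP] := spec M.+1 (fun=> eps) (fun j => x j) (fun j => len j) isT => //.
    by move=> j; rewrite /len; case: ifP => // _; apply: leq_trans kn _; rewrite leq_pmull.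
  by exists z => j jM; have := zP (Ordinal jM); rewrite sum_block_lengths.
have [u uP] := choice finite_spec.
have [|z [_ zu]] := cX (u @ \oo) _; first exact: filterT.
exists z; split.
  apply: (@mistakes_cluster _ _ _ _ _ 0%N _ _ _ _ cf zu).
  by exists 0%N => M _; apply: mistake_ball_card; exact: (uP M 0%N isT).
move=> j; apply: leq_trans gn.
apply: (mistakes_cluster cf zu); exists j.+1 => M jM.
by apply: mistake_ball_card; exact: (uP M j.+1 jM).
Qed.

Lemma almost_specification_horseshoe (h sigma : R) :
  compact [set: X] -> continuous f -> almost_specification f ->
  0 <= h -> 0 < sigma -> (h%:E < htop_scale f [set: X] sigma)%E ->
  exists eps n r A w (e : 'I_A -> nat -> X),
    [/\ 0 < eps, horseshoe f n r eps w e & expR (h * n%:R) <= A%:R].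
Proof.
move=> cX cf [g [eps0 eps00 [gP _]] [k [_ spec]]] h0 s0 hX.
have [h' hh' h'X] := lte_between hX.
(* The ninth ensures 4 eps + 4 eps < sigma. *)
pose eps := Num.min eps0 (sigma / 9).
have eps1 : 0 < eps by rewrite lt_min eps00 divr_gt0.
have epss : eps <= sigma / 9 by rewrite ge_min lexx orbT.
have [gS gcvg] : (forall n, (g n eps <= g n.+1 eps)%N) /\
    ((fun n : nat => (g n eps)%:R / n%:R : R) @ \oo --> (0 : R)).
  by apply: gP; rewrite eps1 ge_min lexx.
have gmono m n : (m <= n)%N -> (g m eps <= g n eps)%N.
  exact: (homo_leq (leqnn) (fun _ _ _ => @leq_trans _ _ _) gS).
(* As h' - eta = h + eta, a factor exp (eta n) is left to absorb the n + 2 in the bound on A + n. *)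
pose eta := (h' - h) / 2.
have [||||||N1 N1P] := @no_small_mistake_cover _ _ f h' (4 * eps) sigma eta
    (fun n => 2 * g (2 * n)%N eps)%N cX h'X; rewrite /eta; try lra.
  move=> d d0; have d40 : 0 < d / 4 by lra.
  have /cvgrPdist_lt/(_ _ d40)[N _ NP] := gcvg.
  exists N.+1 => n Nn; have := NP (2 * n)%N; rewrite /= => /(_ _)/wrap[]; first by lia.
  rewrite sub0r normrN ger0_norm ?divr_ge0// ltr_pdivrMr ?ltr0n; last by lia.
  by rewrite !natrM; lra.
have [|N2 N2P] := @expR_ge_linear eta; first by rewrite /eta; lra.
pose n := maxn (maxn N1 N2) (k eps).+1.
have kn : (k eps < n)%N by rewrite leq_maxr.
have N1n : (N1 <= n)%N by rewrite /n; lia.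
have N2n : (N2 <= n)%N by rewrite /n; lia.
clearbody n.
pose A := alphabet_size h n.
have ext (L : seq (nat -> X)) : (size L <= A + n)%N -> exists2 x, True & forall p, p \in L ->
      (2 * g (2 * n)%N eps < #|mistakes n (4 * eps) (orbit_seq f x) p|)%N.
  move=> sL; have [|x xP] := N1P n N1n L; last by exists x.
  apply: le_trans (_ : (A + n)%:R <= _); first by rewrite ler_nat.
  apply: le_trans (alphabet_size_le n h0) _.
  have -> : (h' - (h' - h) / 2) * n%:R = h * n%:R + eta * n%:R by rewrite /eta; lra.
  by rewrite expRD ler_wpM2l ?expR_ge0//; exact: N2P.
have [x0 _ _] := ext [::] isT.
have [||e hs] := @horseshoe_exists _ _ f _ n (g (2 * n)%N eps) A eps
  (orbit_seq f x0) _ eps1 ext.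
- by lia.
- move=> e _ s; apply: (@almost_specification_follows g k n eps x0 A e s cX cf eps1 spec).
    exact: ltnW.
  by apply: gmono; lia.
exists eps, n, (g (2 * n)%N eps), A, (orbit_seq f x0), e; split=> //.
exact: alphabet_size_ge.
Qed.

End AlmostSpecificationHorseshoe.

(** * Horseshoes from shadowing *)

Section Shadowing.
Context {R : realType} {X : metricType R} (f : X -> X).
Implicit Types (p : nat -> X).

Lemma size_flatten_le (S T : Type) (F : S -> seq T) (s : seq S) (b : R) :
  (forall t, (size (F t))%:R <= b) ->
  (size (flatten [seq F t | t <- s]))%:R <= (size s)%:R * b.
Proof.
move=> Fb; elim: s => [|t s IH] /=; first by rewrite mul0r.
by rewrite size_cat natrD -addn1 natrD mulrDl mul1r addrC lerD.
Qed.

(* An orbit segment splits at the last visit to its first cell v: a loop at v,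
   a point of v, and a segment avoiding v. *)
Lemma loop_cover (m : nat) (c : X -> 'I_m) (y : 'I_m -> X) (x0 : X) (K h rho : R)
    (B : 'I_m -> nat -> seq (nat -> X)) :
  1 <= K -> 0 <= h ->
  (forall x, mdist (y (c x)) x < rho) ->
  (forall v l, (size (B v l))%:R <= K * expR (h * l%:R)) ->
  (forall x l, c (iter l f x) = c x ->
    exists2 p, p \in B (c x) l & mistakes l rho (orbit_seq f x) p == finset.set0) ->
  forall k (S : {set 'I_m}), (#|S| <= k)%N -> forall N,
  exists2 L : seq (nat -> X),
    (size L)%:R <= (K * m.+1%:R * N.+1%:R) ^+ k * expR (h * N%:R) &
    forall x, (forall i, (i < N)%N -> c (iter i f x) \in S) ->
      exists2 p, p \in L & mistakes N rho (orbit_seq f x) p == finset.set0.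
Proof.
move=> K1 h0 yP Bsize BP.
have K0 : 0 <= K by lra.
have expR1 N : 1 <= expR (h * N%:R) by rewrite -expR0 ler_expR mulr_ge0.
have D1 N : 1 <= K * m.+1%:R * N.+1%:R.
  rewrite -mulrA -natrM; apply: (le_trans K1).
  by rewrite ler_peMr ?ler1n ?muln_gt0//; lra.
have trivial_cover N k : (size [:: orbit_seq f x0])%:R <=
    (K * m.+1%:R * N.+1%:R) ^+ k * expR (h * N%:R).
  by rewrite /= -[leLHS]mulr1 ler_pM// exprn_ege1.
(* Induction on the number of cells available: the tail after the last visit to v has one cell
   less. *)
elim=> [|k IH] S Sk N.
  exists [:: orbit_seq f x0]; first exact: trivial_cover.
  move=> x xS; exists (orbit_seq f x0); first by rewrite inE.
  apply/mistakes0P => i iN; have := xS i iN.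
  by move: Sk; rewrite leqn0 cards_eq0 => /eqP ->; rewrite finset.in_set0.
case: N => [|N].
  exists [:: orbit_seq f x0]; first exact: trivial_cover.
  move=> x _; exists (orbit_seq f x0); first by rewrite inE.
  exact/mistakes0P.
have cover v : exists L : nat -> seq (nat -> X), v \in S -> forall M,
    (size (L M))%:R <= (K * m.+1%:R * M.+1%:R) ^+ k * expR (h * M%:R) /\
    forall x, (forall i, (i < M)%N -> c (iter i f x) \in (S :\ v)%SET) ->
      exists2 p, p \in L M & mistakes M rho (orbit_seq f x) p == finset.set0.
  have [vS|vS] := boolP (v \in S); last by exists (fun=> [::]).
  have Svk : (#|(S :\ v)%SET| <= k)%N by move: Sk; rewrite (cardsD1 v) vS.
  have /choice[L LP] : forall M, exists L : seq (nat -> X),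
      (size L)%:R <= (K * m.+1%:R * M.+1%:R) ^+ k * expR (h * M%:R) /\
      forall x, (forall i, (i < M)%N -> c (iter i f x) \in (S :\ v)%SET) ->
      exists2 p, p \in L & mistakes M rho (orbit_seq f x) p == finset.set0.
    by move=> M; have [L L1 L2] := IH _ Svk M; exists L.
  by exists L.
have /choice[L LP] := cover.
pose glue s v (p q : nat -> X) : nat -> X := fun i =>
  if (i < s)%N then p i else if i == s then y v else q (i - s.+1)%N.
pose pieces (t : 'I_m * nat) := if (t.1 \in S) && (t.2 <= N)%N then
  [seq glue t.2 t.1 p q | p <- B t.1 t.2, q <- L t.1 (N - t.2)%N] else [::].
pose starts := [seq (v, s) | v <- enum S, s <- iota 0 N.+1].
exists (flatten [seq pieces t | t <- starts]).
  (* The exponentials of loop and tail multiply to at most exp (h (N + 1)); K and the choices of v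
     and s make up one more factor of the power. *)
  apply: le_trans (size_flatten_le starts
    (b := K * (K * m.+1%:R * N.+2%:R) ^+ k * expR (h * N.+1%:R)) _) _.
    move=> [v s]; rewrite /pieces /=; case: ifP => [/andP[vS sN]|_]; last first.
      apply: mulr_ge0; [apply: mulr_ge0 => //; apply: exprn_ge0|exact: expR_ge0].
      exact: le_trans (D1 _).
    rewrite size_allpairs natrM.
    have [Lsize _] := LP v vS (N - s)%N.
    apply: le_trans (ler_pM _ _ (Bsize v s) Lsize) _ => //.
    rewrite mulrACA -expRD -mulrDr -natrD subnKC//.
    apply: ler_pM; rewrite ?expR_ge0 ?mulr_ge0 ?exprn_ge0 ?mulr_ge0//; try lra.
      apply: ler_wpM2l; first by lra.
      apply: lerXn2r; rewrite ?nnegrE ?mulr_ge0//; try lra.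
      by apply: ler_wpM2l; [rewrite mulr_ge0//; lra|rewrite ler_nat; lia].
    by rewrite ler_expR; apply: ler_wpM2l; rewrite ?ler_nat.
  rewrite size_allpairs size_iota -cardE exprS natrM.
  have -> (u t : R) : #|S|%:R * N.+1%:R * (K * u * t) = K * #|S|%:R * N.+1%:R * (u * t).
    by ring.
  rewrite -[leRHS]mulrA; apply: ler_wpM2r.
    by rewrite mulr_ge0 ?expR_ge0// exprn_ge0// (le_trans _ (D1 _)).
  apply: ler_pM; rewrite ?mulr_ge0 ?ler_nat//.
  apply: ler_wpM2l => //; rewrite ler_nat.
  by apply: leq_trans (max_card _) _; rewrite card_ord.
move=> x xS; pose v := c x.
have vS : v \in S by exact: xS 0%N isT.
have [s [sN sv slast]] : exists s, [/\ (s <= N)%N, c (iter s f x) = v &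
    forall i, (s < i <= N)%N -> c (iter i f x) != v].
  have ex0 : exists i, (i <= N)%N && (c (iter i f x) == v) by exists 0%N => /=.
  have ub i : (i <= N)%N && (c (iter i f x) == v) -> (i <= N)%N by case/andP.
  case: (ex_maxnP ex0 ub) => s /andP[sN /eqP sv] smax.
  exists s; split=> // i /andP[si iN]; apply/negP => iv.
  by have := smax i; rewrite iN iv leqNgt si => /(_ isT).
have [p pB px] := BP x s sv.
have [_ /(_ (iter s.+1 f x))[|q qL qx]] := LP v vS (N - s)%N.
  move=> i iN; rewrite -iterD finset.in_setD1 xS ?andbT; last by lia.
  by apply: slast; lia.
exists (glue s v p q).
  apply/flatten_mapP; exists (v, s).
    by apply: allpairs_f; rewrite ?mem_enum// mem_iota.
  by rewrite /pieces /= vS sN; exact: allpairs_f.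
apply/mistakes0P => i iN; rewrite /glue.
case: ltnP => [si|]; first by move/mistakes0P: px; exact.
rewrite leq_eqVlt eq_sym => /orP[/eqP ->|si].
  by rewrite eqxx metric_sym -sv; apply/ltW; exact: yP.
rewrite gtn_eqF//.
move/mistakes0P: qx => /(_ (i - s.+1)%N)/(_ _)/wrap[]; first by lia.
by rewrite /orbit_seq -iterD subnK.
Qed.

(** Otherwise at most K exp (h l) patterns would catch the loops of length l at each cell, and
    [loop_cover] would cover X by polynomially many times exp (h N) patterns, fewer than exp (h'
    N). *)
Lemma many_loops (m : nat) (c : X -> 'I_m) (y : 'I_m -> X) (K h h' rho sigma : R) :
  1 <= K -> 0 <= h -> h < h' -> 0 < rho -> rho + rho < sigma ->
  (h'%:E < htop_scale f [set: X] sigma)%E ->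
  (forall x, mdist (y (c x)) x < rho) ->
  exists v l, forall L : seq (nat -> X), (size L)%:R <= K * expR (h * l%:R) ->
    exists2 x, c x = v /\ c (iter l f x) = v &
      forall p, p \in L -> mistakes l rho (orbit_seq f x) p != finset.set0.
Proof.
move=> K1 h0 hh' rho0 rs hX yP.
have [||N0 N0P] := @no_small_cover _ _ f h' sigma rho hX _ _ rs; [lra|lra|].
have [x0 _] := N0P N0 (leqnn _) [::] (expR_ge0 _).
apply: contrapT => /forallNP noloop.
have /choice[B BP] : forall v, exists B : nat -> seq (nat -> X), forall l,
    (size (B l))%:R <= K * expR (h * l%:R) /\
    forall x, c x = v -> c (iter l f x) = v ->
    exists2 p, p \in B l & mistakes l rho (orbit_seq f x) p == finset.set0.
  move=> v; suff /choice[B BP] : forall l, exists B : seq (nat -> X),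
      (size B)%:R <= K * expR (h * l%:R) /\
      forall x, c x = v -> c (iter l f x) = v ->
      exists2 p, p \in B & mistakes l rho (orbit_seq f x) p == finset.set0.
    by exists B.
  move=> l; have /forallNP/(_ l)/existsNP[L /not_implyP[sL noL]] := noloop v.
  exists L; split=> // x xv lv; apply: contrapT => /forall2NP noP.
  apply: noL; exists x => // p pL; have [//|/negP //] := noP p.
(* The gap h' - h is shared among m + 1 factors K (m + 1) (N + 1); in each, one half pays for K (m +
   1), the other for N + 1. *)
have d0 : 0 < (h' - h) / m.+1%:R / 2 by rewrite !divr_gt0//; lra.
have [N1 N1P] := expR_ge_linear d0.
have [N2 N2P] := expR_ge_nat (K * m.+1%:R) d0.
pose N := maxn N0 (maxn N1 N2).
have [|||L sL LP] := @loop_cover m c y x0 K h rho B K1 h0 yP _ _ m finset.setT _ N.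
- by move=> v l; case: (BP v l).
- by move=> x l xl; case: (BP (c x) l) => _; exact.
- by rewrite -[leqRHS]card_ord max_card.
have [||x xL] := N0P N _ L; first by rewrite /N leq_maxl.
  apply: le_trans sL _.
  have -> : h' * N%:R =
      ((h' - h) / m.+1%:R / 2 * N%:R + (h' - h) / m.+1%:R / 2 * N%:R) * m.+1%:R
        + h * N%:R by field; rewrite nat1r pnatr_eq0.
  rewrite expRD; apply: ler_wpM2r; first exact: expR_ge0.
  rewrite expRM_natr expRD.
  have DE : K * m.+1%:R * N.+1%:R <=
      expR ((h' - h) / m.+1%:R / 2 * N%:R) * expR ((h' - h) / m.+1%:R / 2 * N%:R).
    apply: ler_pM; rewrite ?mulr_ge0//; first by lra.
      by apply: N2P; rewrite /N; lia.
    apply: le_trans (N1P _ _); last by rewrite /N; lia.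
    by rewrite -natr1; lra.
  apply: le_trans (_ : _ <= (K * m.+1%:R * N.+1%:R) ^+ m.+1) _.
    by apply: ler_weXn2l => //; rewrite -mulrA -natrM; apply: (le_trans K1);
      rewrite ler_peMr ?ler1n ?muln_gt0//; lra.
  by apply: lerXn2r; rewrite ?nnegrE ?mulr_ge0 ?expR_ge0//; lra.
have [i _|p pL] := LP x; first by rewrite finset.in_setT.
by apply/negP; exact: xL.
Qed.

(** Segments of length n from points of [P] concatenate with jumps below delta. The initial pattern
    runs the segment of [x0] twice, to reach length 2 n. *)
Lemma shadowing_follows (n r : nat) (eps delta : R) (P : X -> Prop) (x0 : X) (A : nat)
    (e : 'I_A -> X) (s : nat -> 'I_A) :
  (0 < n)%N -> 0 < delta ->
  (forall u : nat -> X, (forall i, mdist (f (u i)) (u i.+1) < delta) ->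
      exists z : X, forall i, mdist (iter i f z) (u i) < eps) ->
  (forall x x', P x -> P x' -> mdist (iter n f x) x' < delta) ->
  P x0 -> (forall a, P (e a)) ->
  exists z, follows f n r eps (fun i => iter (i %% n) f x0)
    (fun a => orbit_seq f (e a)) s z.
Proof.
move=> n0 d0 shad Pn Px0 Pe.
pose b j := if j is j'.+2 then e (s j') else x0.
have Pb j : P (b j) by case: j => [//|[//|j]]; exact: Pe.
pose u i := iter (i %% n) f (b (i %/ n)%N).
have [i|z zu] := shad u.
  rewrite /u -iterS; have [iS|iS] := eqVneq (i %% n).+1 n.
    have -> : (i.+1 = (i %/ n).+1 * n)%N.
      by rewrite {1}(divn_eq i n) -addnS iS mulSn addnC.
    by rewrite modnMl mulnK// iS; apply: Pn; exact: Pb.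
  have iS' : ((i %% n).+1 < n)%N by rewrite ltn_neqAle iS ltn_pmod.
  have -> : (i.+1 = i %/ n * n + (i %% n).+1)%N by rewrite addnS -divn_eq.
  by rewrite modnMDl divnMDl// (modn_small iS') (divn_small iS') addn0 mdistxx.
have zb i j : (i < n)%N -> mdist (iter (j * n + i) f z) (iter i f (b j)) <= eps.
  move=> ni; have := zu (j * n + i)%N.
  by rewrite /u modnMDl divnMDl// (modn_small ni) (divn_small ni) addn0 => /ltW.
exists z; split=> [|j].
  rewrite (_ : mistakes _ _ _ _ = finset.set0) ?cards0//; apply/eqP/mistakes0P => i ni.
  rewrite /orbit_seq {1}(divn_eq i n).
  have := zb (i %% n)%N (i %/ n)%N (ltn_pmod _ n0).
  have : (i %/ n < 2)%N by rewrite ltn_divLR.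
  by case: (i %/ n)%N => [|[]].
rewrite (_ : mistakes _ _ _ _ = finset.set0) ?cards0//; apply/eqP/mistakes0P => i ni.
by rewrite /orbit_seq -iterD addnC; exact: zb.
Qed.

Lemma shadowing_horseshoe (h sigma : R) :
  compact [set: X] -> shadowing f ->
  0 <= h -> 0 < sigma -> (h%:E < htop_scale f [set: X] sigma)%E ->
  exists eps n r A w (e : 'I_A -> nat -> X),
    [/\ 0 < eps, horseshoe f n r eps w e & expR (h * n%:R) <= A%:R].
Proof.
move=> cX shad h0 s0 hX.
have [h' hh' h'X] := lte_between hX.
pose eps := sigma / 9.
have eps0 : 0 < eps by rewrite divr_gt0.
have [delta d0 dP] := shad eps eps0.
(* The bound 4 eps serves the count of loops; delta / 2 makes any two points of a cell
   delta-close. *)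
have [|m [c [y yP]]] := @finite_net _ _ (Num.min (4 * eps) (delta / 2)) cX.
  by rewrite lt_min; apply/andP; split; lra.
have y4 x : mdist (y (c x)) x < 4 * eps by apply: lt_le_trans (yP x) _; rewrite ge_min lexx.
have yd x : mdist (y (c x)) x < delta / 2.
  by apply: lt_le_trans (yP x) _; rewrite ge_min lexx orbT.
pose a := (h' - h) / 2; have a0 : 0 < a by rewrite /a; lra.
have ia0 : 0 < a^-1 by rewrite invr_gt0.
have eps4 : 0 < 4 * eps by lra.
have eps8 : 4 * eps + 4 * eps < sigma by rewrite /eps; lra.
(* This constant gives (2 + 1 / a) (1 + a n) >= n + 2 for every n, which matters because the loop
   length n cannot be taken large at will. *)
have aK : 1 <= 2 + a^-1 by lra.
have ha0 : 0 <= h + a by lra.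
have hah' : h + a < h' by rewrite /a; lra.
have [v [n nP]] := many_loops aK ha0 hah' eps4 eps8 h'X y4.
(* A loop of length 0 is caught by any one-element list. *)
have n0 : (0 < n)%N.
  case: n nP => // /(_ [:: fun=> y v])[|x _ /(_ _ (mem_head _ _))/negP[]].
    by rewrite mulr0 expR0 /=; lra.
  exact/mistakes0P.
pose A := alphabet_size h n.
have ext (L : seq (nat -> X)) : (size L <= A + n)%N ->
    exists2 x, c x = v /\ c (iter n f x) = v & forall p, p \in L ->
      (2 * 0 < #|mistakes n (4 * eps) (orbit_seq f x) p|)%N.
  move=> sL; have [|x xv xL] := nP L; last first.
    by exists x => // p /xL; rewrite muln0 card_gt0.
  apply: le_trans (_ : (A + n)%:R <= _); first by rewrite ler_nat.
  apply: le_trans (alphabet_size_le n h0) _.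
  rewrite [(h + a) * _]mulrDl expRD mulrCA; apply: ler_wpM2l; first exact: expR_ge0.
  apply: le_trans (_ : (2 + a^-1) * (1 + a * n%:R) <= _).
    have -> : (2 + a^-1) * (1 + a * n%:R) = n%:R + 2 + (a^-1 + 2 * (a * n%:R)).
      by field; rewrite gt_eqF.
    by have : 0 <= a * n%:R by [rewrite mulr_ge0// ltW]; lra.
  by apply: ler_wpM2l; [lra|exact: expR_ge1Dx].
have [x0 x0v _] := ext [::] isT.
have close x x' : c x = v /\ c (iter n f x) = v -> c x' = v /\ c (iter n f x') = v ->
    mdist (iter n f x) x' < delta.
  move=> [_ xv] [x'v _]; apply: le_lt_trans (mdist_triangle_sym _ _ (y v)) _.
  have := yd (iter n f x); have := yd x'; rewrite xv x'v !(metric_sym (y v)); lra.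
have [|e hs] := @horseshoe_exists _ _ f _ n 0 A eps (fun i => iter (i %% n) f x0) n0 eps0 ext.
  by move=> e ev s; apply: (@shadowing_follows n 0 eps delta _ x0 A e s n0 d0 dP close).
exists eps, n, 0%N, A, (fun i => iter (i %% n) f x0), e; split=> //.
exact: alphabet_size_ge.
Qed.

End Shadowing.

Theorem theorem1 (R : realType) (X : metricType R) (f : X -> X)
  (compactX : compact [set: X]) (contf : continuous f)
  (spec : shadowing f \/ almost_specification f) :
  htop f (NRec f) = htop f [set: X].
Proof.
apply/eqP; rewrite eq_le; apply/andP; split; first exact: htopS.
rewrite [leLHS]htopE; apply: ge_ereal_sup => _ [sigma s0 <-].
rewrite leNgt; apply/negP => lt.
(* The assumed strict inequality makes the entropy of [NRec f] a real [a]; a horseshoe for some h >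
   a contradicts it. *)
have [a aN] : exists a, htop f (NRec f) = a%:E.
  case: (htop f (NRec f)) (htop_scale_le_htop f (NRec f) ltr01) lt => [a| |].
  - by exists a.
  - by move=> _; rewrite ltNge leey.
  - by move=> h0 _; have := le_trans (htop_scale_ge0 f (NRec f) 1) h0.
have a0 : 0 <= a.
  rewrite -lee_fin -aN; apply: le_trans (htop_scale_le_htop f (NRec f) ltr01).
  exact: htop_scale_ge0.
move: lt; rewrite aN => /lte_between[h ah hX].
have h0 : 0 <= h by lra.
have [eps [n [r [A [w [e [eps0 hs hA]]]]]]] : exists eps n r A w (e : 'I_A -> nat -> X),
    [/\ 0 < eps, horseshoe f n r eps w e & expR (h * n%:R) <= A%:R].
  case: spec => sp; first exact: shadowing_horseshoe hX.
  exact: almost_specification_horseshoe hX.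
have := le_trans (horseshoe_entropy contf eps0 hs hA) (htop_scale_le_htop f (NRec f) eps0).
by rewrite aN lee_fin; lra.
Qed.
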